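(* Let $\Lambda$ be a finite dimensional algebra over a field. If the torsion class in $\mathrm{mod}\,\Lambda$ generated by all finitely generated injective $\Lambda$-modules contains all finitely generated $\Lambda$-modules, then $\operatorname{Findim}\Lambda<\infty$.
   Context: $\mathrm{mod}\,\Lambda$ is the category of finitely generated right $\Lambda$-modules. The torsion class generated by a class of modules is the smallest full subcategory of $\mathrm{mod}\,\Lambda$ containing it and closed under isomorphisms, quotients, extensions and finite direct sums. $\operatorname{Findim}\Lambda$ is the supremum of the projective dimensions of all (not necessarily finitely generated) right $\Lambda$-modules of finite projective dimension. *)

(* Defs.v *)
From HB Require Import structures.
From mathcomp Require Import all_boot all_order all_algebra all_field.

Set Implicit Arguments.
Unset Strict Implicit.
Unset Printing Implicit Defensive.

Import GRing.Theory.
Local Open Scope ring_scope.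

(* The module theory below is stated for left modules over a ring R. Right
   modules over A are left modules over the converse ring A^c, where [a *: x]
   stands for the right action x.a. *)
Notation rmodType A := (lmodType (A^c)%type).

Section Modules.
Variable R : pzRingType.
Implicit Types M N P I Z : lmodType R.

Definition surj (U V : Type) (f : U -> V) : Prop := forall y, exists x, f x = y.

Definition fin_gen M : Prop :=
  exists (n : nat) (v : 'I_n -> M),
    forall x : M, exists c : 'I_n -> R, x = \sum_(i < n) c i *: v i.

Definition isomorphic M N : Prop := exists f : {linear M -> N}, bijective f.

Definition exact_at M N P (f : {linear M -> N}) (g : {linear N -> P}) : Prop :=
  forall y : N, g y = 0 <-> exists x : M, f x = y.

Definition short_exact M N P (f : {linear M -> N}) (g : {linear N -> P}) : Prop :=
  [/\ injective f, exact_at f g & surj g].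

Definition is_zero M : Prop := forall x : M, x = 0.

Definition projective P : Prop :=
  forall M N (g : {linear M -> N}) (f : {linear P -> N}),
    surj g -> exists h : {linear P -> M}, forall x, g (h x) = f x.

Definition injective_module I : Prop :=
  forall M N (i : {linear M -> N}) (f : {linear M -> I}),
    injective i -> exists h : {linear N -> I}, forall x, h (i x) = f x.

(* An exact complex ... -> P 1 -> P 0 -> M -> 0 of projectives with P i = 0 for
   all i > n. *)
Definition has_proj_resolution M (n : nat) : Prop :=
  exists (P : nat -> lmodType R) (d : forall i, {linear P i.+1 -> P i})
         (e : {linear P 0%N -> M}),
    [/\ forall i, projective (P i),
        surj e,
        exact_at (d 0%N) e,
        forall i, exact_at (d i.+1) (d i)
      & forall i, (n < i)%N -> is_zero (P i)].

(* M has projective dimension exactly n; no such n exists if pd M = oo. The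
   zero module gets projective dimension 0. *)
Definition is_projdim M (n : nat) : Prop :=
  has_proj_resolution M n /\
  forall m, has_proj_resolution M m -> (n <= m)%N.

(* N is the supremum of the projective dimensions of the modules, finitely
   generated or not, of finite projective dimension. *)
Definition is_Findim (N : nat) : Prop :=
  (forall M n, is_projdim M n -> (n <= N)%N) /\
  (forall K, (forall M n, is_projdim M n -> (n <= K)%N) -> (N <= K)%N).

(* Full subcategories of the finitely generated modules are given by their class
   of objects. Finite direct sums are generated by the empty sum and the binary
   ones. *)
Record torsion_class (T : lmodType R -> Prop) : Prop := TorsionClass {
  torsion_fin_gen : forall M, T M -> fin_gen M;
  torsion_iso : forall M N, isomorphic M N -> T M -> T N;
  torsion_quotient : forall M N (g : {linear M -> N}), surj g -> T M -> T N;
  torsion_extension : forall M N P (f : {linear M -> N}) (g : {linear N -> P}),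
    short_exact f g -> T M -> T P -> T N;
  torsion_zero : forall Z, is_zero Z -> T Z;
  torsion_sum : forall M N, T M -> T N -> T (M * N)%type
}.

(* The smallest torsion class containing C. *)
Definition torsion_generated (C : lmodType R -> Prop) (M : lmodType R) : Prop :=
  forall T : lmodType R -> Prop,
    torsion_class T -> (forall N, C N -> T N) -> T M.

Definition fin_gen_injective M : Prop := fin_gen M /\ injective_module M.

End Modules.

(* Findim A < oo, for right A-modules. *)
Definition Findim_finite (A : pzRingType) : Prop :=
  exists N, is_Findim (A^c)%type N.

(* Main.v *)
(* The hypothesis forces every module of finite projective dimension to be
   projective. Suppose pd M = n + 1 and let d : P -> Q be the injective last map
   of a projective resolution of length n + 1. As P and Q are projective, the
   finitely generated modules N such that every P -> N extends along d (in
   homological terms, Ext^(n+1)(M, N) = 0) form a torsion class. It contains the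
   finitely generated injectives, hence Lambda. So the coordinates P -> Lambda of
   a section of the free cover Lambda^(P) -> P all extend to Q, giving a map
   Q -> Lambda^P into the full product. As Lambda is finite dimensional,
   Lambda^(P) and Lambda^P are obtained from k^(P) and k^P by tensoring with
   Lambda over k, so the inclusion Lambda^(P) -> Lambda^P splits because
   k^(P) -> k^P does, and d is a split monomorphism. Its image can then be
   removed, giving a resolution of length n, a contradiction. *)
Require Import Defs.
From HB Require Import structures.
From mathcomp Require Import all_boot all_order all_algebra all_field.
From mathcomp Require Import boolp classical_sets functions.
From mathcomp Require Import freeg.
(* [functions] shadows [surj]. *)
Import Defs.

Set Implicit Arguments.
Unset Strict Implicit.
Unset Printing Implicit Defensive.

Import GRing.Theory.
Local Open Scope ring_scope.

Definition Linear_of (R : pzRingType) (U V : lmodType R) (f : U -> V)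
  (fL : linear f) : {linear U -> V} := HB.pack f (GRing.isLinear.Build R U V _ f fL).

Section Modules.
Variable R : pzRingType.
Implicit Types K L M N P Q : lmodType R.

Lemma factor_surj M N P (e : {linear M -> N}) (f : {linear M -> P}) :
    surj e -> (forall x, e x = 0 -> f x = 0) ->
  exists g : {linear N -> P}, forall x, g (e x) = f x.
Proof.
move=> eS kf; have [s sK] := choice eS.
have fs x : f (s (e x)) = f x.
  by apply/eqP; rewrite -subr_eq0 -linearB kf // linearB /= sK subrr.
have gL : linear (f \o s).
  by move=> a x y /=; rewrite -linearP -[RHS]fs linearP /= !sK.
by exists (Linear_of gL).
Qed.

Lemma factor_inj M N P (j : {linear N -> P}) (f : {linear M -> P}) :
    injective j -> (forall x, exists y, j y = f x) ->
  exists g : {linear M -> N}, forall x, j (g x) = f x.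
Proof.
move=> jI fj; have [s sK] := choice fj.
have gL : linear s by move=> a x y; apply: jI; rewrite linearP /= !sK linearP.
by exists (Linear_of gL).
Qed.

Definition kernel M N (f : {linear M -> N}) : {pred M} := fun x => f x == 0.

Lemma kernel_submod M N (f : {linear M -> N}) : submod_closed (kernel f).
Proof.
split=> [|a x y]; rewrite !unfold_in ?linear0 // => /eqP fx /eqP fy.
by rewrite linearP fx fy scaler0 addr0.
Qed.

HB.instance Definition _ M N (f : {linear M -> N}) :=
  GRing.isSubmodClosed.Build R M (kernel f) (kernel_submod f).

Definition kernel_type M N (f : {linear M -> N}) := {x : M | x \in kernel f}.
HB.instance Definition _ M N (f : {linear M -> N}) :=
  SubChoice.on (kernel_type f).
HB.instance Definition _ M N (f : {linear M -> N}) :=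
  [SubChoice_isSubLmodule of kernel_type f by <:].

Definition kernel_incl M N (f : {linear M -> N}) :
  {linear kernel_type f -> M} := val.

Lemma kernel_exact M N (f : {linear M -> N}) : exact_at (kernel_incl f) f.
Proof.
move=> y; split=> [fy|[[x xf] <-]]; last exact/eqP.
have yf : y \in kernel f by exact/eqP.
by exists (Sub y yf).
Qed.

Lemma projective_retract P Q (s : {linear P -> Q}) (r : {linear Q -> P}) :
  cancel s r -> projective Q -> projective P.
Proof.
move=> sK pQ M N g f gS; have [h hE] := pQ M N g (f \o r) gS.
by exists (h \o s) => x /=; rewrite hE /= sK.
Qed.

Definition is_resolution M (P : nat -> lmodType R)
    (d : forall i, {linear P i.+1 -> P i}) (e : {linear P 0%N -> M}) (n : nat) :=
  [/\ forall i, projective (P i), surj e, exact_at (d 0%N) e,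
      forall i, exact_at (d i.+1) (d i)
    & forall i, (n < i)%N -> is_zero (P i)].

Lemma row0_is_zero : is_zero 'rV[R]_0.
Proof. exact: thinmx0. Qed.

Lemma is_zero_projective P : is_zero P -> projective P.
Proof.
move=> P0 M N g f _; exists \0 => x.
by rewrite linear0 (P0 x) linear0.
Qed.

Lemma resolution_cons M K (P0 : lmodType R) n
    (e : {linear P0 -> M}) (j : {linear K -> P0}) :
    projective P0 -> surj e -> injective j -> exact_at j e ->
  has_proj_resolution K n -> has_proj_resolution M n.+1.
Proof.
move=> pP0 eS jI je [P [d [e' [pP e'S d0e' dd P0n]]]].
pose P' i := if i is i'.+1 then P i' else P0.
pose d' i : {linear P' i.+1 -> P' i} :=
  match i with 0%N => (j \o e' : {linear _ -> _}) | i'.+1 => d i' end.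
exists P', d', e; split=> //.
- by case.
- move=> y; rewrite je; split=> [[x <-]|[x <-]]; last by exists (e' x).
  by have [z <-] := e'S x; exists z.
- case=> [|i]; last exact: dd.
  move=> y /=; rewrite -d0e'; split=> [|->]; last exact: linear0.
  by rewrite -(linear0 j) => /jI.
- by case=> // i; apply: P0n.
Qed.

Lemma projective_resolution M : projective M -> has_proj_resolution M 0.
Proof.
move=> pM; pose P i : lmodType R := if i is i'.+1 then 'rV[R]_0 else M.
have d i : {linear P i.+1 -> P i} by exact: \0.
have P0 i : is_zero (P i.+1) by exact: row0_is_zero.
exists P, d, idfun; split.
- by case=> // i; apply: is_zero_projective (P0 i).
- by move=> y; exists y.
- move=> y; split=> [/= ->|[x <-]]; first by exists 0; rewrite linear0.
  by rewrite (P0 _ x) linear0.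
- move=> i y; split=> [_|_]; last by rewrite (P0 _ y) linear0.
  by exists 0; rewrite linear0 (P0 _ y).
- by case.
Qed.

Lemma drop_last M n (P : nat -> lmodType R) (d : forall i, {linear P i.+1 -> P i})
    (e : {linear P 0%N -> M}) (r : {linear P n -> P n.+1}) :
  is_resolution d e n.+1 -> cancel (d n) r -> has_proj_resolution M n.
Proof.
elim: n => [|n IHn] in M P d e r *; case=> pP eS d0e dd P0 rK.
  have [x|s sE] := @factor_surj _ _ _ e (idfun \- (d 0%N \o r)) eS.
    by move/d0e => [y <-] /=; rewrite rK subrr.
  apply: projective_resolution.
  apply: (@projective_retract _ _ s e) => [y|//].
  have [x <-] := eS y; rewrite sE linearB /=.
  have -> : e (d 0%N (r x)) = 0 by apply/d0e; exists (r x).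
  by rewrite subr0.
have [x|e' e'E] := @factor_inj _ _ _ (kernel_incl e) (d 0%N) val_inj.
  by apply/kernel_exact/d0e; exists x.
have inclI : injective (kernel_incl e) by exact: val_inj.
apply: (@resolution_cons M _ _ n e (kernel_incl e)) => //.
  exact: kernel_exact.
apply: (IHn _ (fun i => P i.+1) (fun i => d i.+1) e' r) => //; split=> //.
- move=> y; have /d0e[x dx] : e (kernel_incl e y) = 0.
    by apply/kernel_exact; exists y.
  by exists x; apply: inclI; rewrite e'E.
- move=> y; rewrite -dd -e'E; split=> [->|]; first exact: linear0.
  by rewrite -(linear0 (kernel_incl e)) => /inclI.
- by move=> i ni; apply: P0.
Qed.

Lemma fin_gen_surj M N (g : {linear M -> N}) : surj g -> fin_gen M -> fin_gen N.
Proof.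
move=> gS [n [v vgen]]; exists n, (g \o v) => y.
have [x <-] := gS y; have [c ->] := vgen x; exists c.
by rewrite linear_sum; apply: eq_bigr => i _; rewrite linearZ.
Qed.

Lemma fin_gen_extension M N P (f : {linear M -> N}) (g : {linear N -> P}) :
  short_exact f g -> fin_gen M -> fin_gen P -> fin_gen N.
Proof.
case=> _ fg gS [m [v vgen]] [n [w wgen]].
have [w' w'E] := choice (fun j => gS (w j)).
pose u i := match fintype.split i with inl a => f (v a) | inr b => w' b end.
exists (m + n)%N, u => x; have [c cE] := wgen (g x).
have /fg[y yE] : g (x - \sum_j c j *: w' j) = 0.
  rewrite linearB cE linear_sum; apply/eqP; rewrite subr_eq0; apply/eqP.
  by apply: eq_bigr => j _; rewrite linearZ /= w'E.
have [b bE] := vgen y.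
exists (fun i => match fintype.split i with inl a => b a | inr j => c j end).
rewrite big_split_ord /= -[LHS](subrK (\sum_j c j *: w' j)) -yE bE linear_sum.
congr (_ + _); apply: eq_bigr => j _; rewrite /u.
  by rewrite -[lshift n j]/(unsplit (inl j)) unsplitK linearZ.
by rewrite -[rshift m j]/(unsplit (inr j)) unsplitK.
Qed.

Lemma fin_gen_zero M : is_zero M -> fin_gen M.
Proof.
by move=> M0; exists 0%N, (fun=> 0) => x; exists (fun=> 0); rewrite big_ord0.
Qed.

Lemma short_exact_prod M N :
  exists (f : {linear M -> (M * N)%type}) (g : {linear (M * N)%type -> N}), short_exact f g.
Proof.
have fL : linear (fun x : M => (x, 0 : N)).
  by move=> a x y; congr pair; rewrite /= scaler0 addr0.
have gL : linear (@snd M N) by [].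
exists (Linear_of fL), (Linear_of gL); split=> [x y [] //|[x z]|z].
  by split=> /= [->|[y [_ <-]] //]; exists x.
by exists (0, z).
Qed.

Definition extends_along P Q (i : {linear P -> Q}) M :=
  forall f : {linear P -> M}, exists h : {linear Q -> M}, forall x, h (i x) = f x.

Lemma extends_along_quotient P Q (i : {linear P -> Q}) M N (g : {linear M -> N}) :
  projective P -> surj g -> extends_along i M -> extends_along i N.
Proof.
move=> pP gS eM f; have [f' f'E] := pP _ _ g f gS; have [h hE] := eM f'.
by exists (g \o h) => x; rewrite -f'E -hE.
Qed.

Lemma extends_along_extension P Q (i : {linear P -> Q}) L M N
    (f : {linear L -> M}) (g : {linear M -> N}) :
  projective Q -> short_exact f g ->
  extends_along i L -> extends_along i N -> extends_along i M.
Proof.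
move=> pQ [fI fg gS] eL eN u; have [v vE] := eN (g \o u).
have [w wE] := pQ _ _ g v gS.
have [x|u' u'E] := @factor_inj _ _ _ f (u \- (w \o i)) fI.
  by apply/fg; rewrite /= linearB wE vE subrr.
have [t tE] := eL u'.
by exists (w \+ (f \o t)) => x; rewrite /= tE u'E /= addrC subrK.
Qed.

Lemma extends_along_torsion P Q (i : {linear P -> Q}) :
    projective P -> projective Q ->
  torsion_class (fun M => fin_gen M /\ extends_along i M).
Proof.
move=> pP pQ.
have quotient M N (g : {linear M -> N}) : surj g ->
    fin_gen M /\ extends_along i M -> fin_gen N /\ extends_along i N.
  move=> gS [fM eM]; split; first exact: fin_gen_surj gS fM.
  exact: extends_along_quotient pP gS eM.
have extension L M N (f : {linear L -> M}) (g : {linear M -> N}) :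
    short_exact f g -> fin_gen L /\ extends_along i L ->
    fin_gen N /\ extends_along i N -> fin_gen M /\ extends_along i M.
  move=> fg [fL eL] [fN eN]; split; first exact: fin_gen_extension fg fL fN.
  exact: extends_along_extension pQ fg eL eN.
split=> //.
- by move=> M [].
- by move=> M N [f [f' fK f'K]]; apply: (quotient _ _ f) => y; exists (f' y).
- move=> Z Z0; split; first exact: fin_gen_zero.
  by move=> f; exists \0 => x; rewrite (Z0 (f x)).
- by move=> M N; have [f [g fg]] := short_exact_prod M N; apply: extension fg.
Qed.

End Modules.

Section LinearExtension.
Variables (k : fieldType) (V W U : lmodType k).

Definition linear_relation (G : set (W * U)) :=
  forall a p q, G p -> G q -> G (a *: p.1 + q.1, a *: p.2 + q.2).

Definition functional_relation (G : set (W * U)) := forall u, G (0, u) -> u = 0.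

Lemma linear_relation_extend (G : set (W * U)) (w0 : W) :
    linear_relation G -> functional_relation G -> G (0, 0) ->
    (forall u, ~ G (w0, u)) ->
  let G' := [set p | exists c, G (p.1 - c *: w0, p.2)]%classic in
  linear_relation G' /\ functional_relation G'.
Proof.
move=> lG fG G0 w0G /=; split=> [a p q [c Gc] [b Gb]|u [c /=]].
  exists (a * c + b); move: (lG a _ _ Gc Gb) => /=.
  by rewrite scalerBr scalerA addrACA -opprD -scalerDl.
have [->|c0] := eqVneq c 0; first by rewrite scale0r subr0 => /fG.
rewrite sub0r => Gc; case: (w0G (- c^-1 *: u)).
move: (lG (- c^-1) _ _ Gc G0) => /=.
by rewrite !addr0 scaleNr scalerN opprK scalerA mulVf // scale1r.
Qed.

Lemma maximal_linear_relation (G0 : set (W * U)) :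
    linear_relation G0 -> functional_relation G0 -> G0 (0, 0) ->
  exists G : set (W * U), [/\ (G0 `<=` G)%classic, linear_relation G,
    functional_relation G & forall w, exists u, G (w, u)].
Proof.
move=> lG0 fG0 G00.
pose good (X : set (W * U)) :=
  linear_relation (X `|` G0)%classic /\ functional_relation (X `|` G0)%classic.
have chain F : (F `<=` good)%classic -> total_on F subset ->
    good (\bigcup_(X in F) X)%classic.
  move=> Fgood Ftot; split.
    move=> a p q [[X FX Xp]|Gp] [[Y FY Yq]|Gq].
    - have [Z [FZ Zp Zq]] : exists Z, [/\ F Z, Z p & Z q].
        have [XY|YX] := Ftot _ _ FX FY; first by exists Y; split=> //; apply: XY.
        by exists X; split=> //; apply: YX.
      have [lZ _] := Fgood _ FZ.
      by case: (lZ a p q (or_introl Zp) (or_introl Zq)); [left; exists Z | right].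
    - have [lX _] := Fgood _ FX.
      by case: (lX a p q (or_introl Xp) (or_intror Gq)); [left; exists X | right].
    - have [lY _] := Fgood _ FY.
      by case: (lY a p q (or_intror Gp) (or_introl Yq)); [left; exists Y | right].
    - by right; apply: lG0.
  move=> u [[X FX Xu]|]; last exact: fG0.
  by have [_ fX] := Fgood _ FX; apply: fX; left.
have [X [[lG fG] maxX]] := Zorn_bigcup chain.
exists (X `|` G0)%classic; split=> // w.
apply: contrapT => /forallNP wG.
have [lG' fG'] := linear_relation_extend lG fG (or_intror G00) wG.
set G' := [set _ | _]%classic in lG' fG'.
have GG' p : (X `|` G0)%classic p -> G' p.
  by case: p => v u Gp; exists 0; rewrite scale0r subr0.
apply: (maxX G') => //; last first.
  by rewrite /good setUidl // => p G0p; apply: GG'; right.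
split=> [p Xp|sub]; first by apply: GG'; left.
apply: (wG 0); left; apply: sub.
by exists 1; rewrite scale1r subrr; right.
Qed.

Lemma linear_extension (i : {linear V -> W}) (f : {linear V -> U}) :
  injective i -> exists h : {linear W -> U}, forall x, h (i x) = f x.
Proof.
move=> iI; pose G0 p := exists x, p = (i x, f x).
have lG0 : linear_relation G0.
  by move=> a _ _ [x ->] [y ->]; exists (a *: x + y); rewrite !linearP.
have fG0 : functional_relation G0.
  by move=> u [x [/esym + ->]]; rewrite -(linear0 i) => /iI ->; rewrite linear0.
have G00 : G0 (0, 0) by exists 0; rewrite !linear0.
have [G [G0G lG fG tG]] := maximal_linear_relation lG0 fG0 G00.
have [h hG] := choice tG.
have hE w u : G (w, u) -> h w = u.
  move=> Gu; apply/eqP; rewrite -subr_eq0; apply/eqP/fG.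
  have := lG (-1) _ _ Gu (hG w).
  by rewrite /= !scaleN1r addNr [X in (_, X)]addrC.
have hL : linear h by move=> a x y; apply: hE; apply: (lG a (x, _) (y, _)).
by exists (Linear_of hL) => x; apply: hE; apply: G0G; exists x.
Qed.

End LinearExtension.

Section FreeModule.
Variables (R : nzRingType) (K : choiceType).

Lemma coeff_linear x : linear (coeff x : {freeg K / R} -> R^o).
Proof. by move=> a D E; rewrite coeffD coeffZ. Qed.

Lemma fglift_linear (M : lmodType R) (v : K -> M) : linear (fglift v).
Proof.
pose f : {additive {freeg K / R} -> M} :=
  HB.pack (fglift v) (GRing.isZmodMorphism.Build _ _ _ (lift_is_additive v)).
have fZ a D : fglift v (a *: D) = a *: fglift v D.
  rewrite -{2}(freeg_sumE D) -![fglift v _]/(f _) (_ : a *: D = fgscale a D) //.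
  rewrite /fgscale !raddf_sum; apply: eq_bigr => x _.
  by rewrite /= !liftU scalerA.
by move=> a D E; rewrite -[LHS]/(f _) raddfD /= fZ.
Qed.

Lemma fgliftE (M : lmodType R) (v : K -> M) D :
  fglift v D = \sum_(x <- dom D) coeff x D *: v x.
Proof.
rewrite -{1}(freeg_sumE D) -[fglift v]/(Linear_of (fglift_linear v) : _ -> _).
by rewrite linear_sum; apply: eq_bigr => x _; rewrite /= liftU.
Qed.

Lemma coeff_sum_dom (s : seq K) (c : K -> R) x :
    uniq s -> (forall x, x \notin s -> c x = 0) ->
  coeff x (\sum_(z <- s) << c z *g z >>) = c x.
Proof.
move=> us c0; rewrite raddf_sum /=; have [xs|xs] := boolP (x \in s).
  rewrite (bigD1_seq x) //= coeffU eqxx mulr1 big1 ?addr0 // => z /negPf zx.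
  by rewrite coeffU zx mulr0.
rewrite c0 // big1_seq // => z /= zs; rewrite coeffU.
by case: eqP => [zx|_]; [rewrite -zx zs in xs | rewrite mulr0].
Qed.

End FreeModule.

Lemma projective_section (R : nzRingType) (P : lmodType R) : projective P ->
  exists s : {linear P -> {freeg P / R}}, forall p, fglift id (s p) = p.
Proof.
move=> pP; pose g := Linear_of (@fglift_linear R P P id).
have [|s sE] := pP _ _ g idfun.
  by move=> y; exists << 1 *g y >>; rewrite /= liftU scale1r.
by exists s.
Qed.

Section Algebra.
Variables (k : fieldType) (A : falgType k).

Definition restrict (M : rmodType A) : Type := M.

HB.instance Definition _ (M : rmodType A) := GRing.Zmodule.on (restrict M).

Section RestrictScalars.
Variable M : rmodType A.

Definition restrict_scale (c : k) (x : restrict M) : restrict M :=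
  ((c%:A : A) : A^c) *: (x : M).

Let scaleA a b x : restrict_scale a (restrict_scale b x) = restrict_scale (a * b) x.
Proof.
rewrite /restrict_scale scalerA; congr (_ *: _).
by rewrite -[LHS]/((b%:A : A) * a%:A) -scalerAl mul1r scalerA mulrC.
Qed.

Let scale1 : left_id 1 restrict_scale.
Proof. by move=> x; rewrite /restrict_scale scale1r [LHS]scale1r. Qed.

Let scaleDr : right_distributive restrict_scale +%R.
Proof. by move=> a x y; apply: (scalerDr (_ : A^c)). Qed.

Let scaleDl x : {morph restrict_scale^~ x : a b / a + b}.
Proof. by move=> a b; rewrite /restrict_scale scalerDl [LHS]scalerDl. Qed.

HB.instance Definition _ := GRing.Zmodule_isLmodule.Build k (restrict M)
  scaleA scale1 scaleDr scaleDl.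

End RestrictScalars.

Lemma split_mono (P Q : rmodType A) (i : {linear P -> Q}) :
  projective P -> extends_along i (A^c)^o ->
  exists r : {linear Q -> P}, cancel i r.
Proof.
move=> pP extA; have [s sK] := projective_section pP.
pose coeffL x := Linear_of (@coeff_linear (A^c)%type P x).
have [psi psiE] := choice (fun x => extA (coeffL x \o s)).
pose ev : {freeg P / k} -> P -> k^o := fun D x => coeff x D.
have evL : linear ev by move=> a D E; apply/funext => x; apply: coeff_linear.
have evI : injective ev.
  by move=> D E /funeqP DE; apply/eqP/freeg_eqP => x; apply: DE.
have [T TE] := @linear_extension _ _ _ _ (Linear_of evL)
  (Linear_of (@fglift_linear k P (restrict P) id)) evI.
(* [T] extends the evaluation k^(P) -> P to k^P; the retraction is obtained from
   it by the base change from k to A, computed in the basis [e]. *)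
pose e := vbasis {:A}; pose co j (a : A) : k := coord e j a.
have eE (a : A) : a = \sum_j co j a *: e`_j by exact/coord_vbasis/memvf.
pose u (j : 'I_(\dim {:A})) q : P -> k^o := fun x => co j (psi x q).
pose t (j : 'I_(\dim {:A})) q : P := T (u j q).
pose act (a : A) (x : P) : P := (a : A^c) *: x.
have tL j a x y :
    t j (a *: x + y) =
      \sum_(m < \dim {:A}) act (co j (e`_m * a))%:A (t m x) + t j y.
  suff -> : t j (a *: x + y) =
      T (\sum_(m < \dim {:A}) co j (e`_m * a) *: u m x + u j y).
    by rewrite linearD linear_sum; congr (_ + _); apply: eq_bigr => m _;
      rewrite linearZ.
  congr (T _); apply/funext => z; rewrite fctE fct_sumE /u linearP /=.
  rewrite -[a *: psi z x + _]/((psi z x : A) * a + _) /co linearD; congr (_ + _).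
  rewrite {1}(eE (psi z x)) mulr_suml linear_sum; apply: eq_bigr => m _.
  by rewrite -scalerAl linearZ; apply: mulrC.
pose r q := \sum_(j < \dim {:A}) act e`_j (t j q).
have rL : linear r.
  move=> a x y; rewrite /r scaler_sumr.
  under eq_bigr => j _ do rewrite tL /act scalerDr scaler_sumr.
  rewrite big_split exchange_big; congr (_ + _); apply: eq_bigr => m _.
  rewrite /act scalerA.
  under eq_bigr => j _ do rewrite scalerA.
  rewrite -scaler_suml; congr (_ *: _).
  rewrite -[RHS]/((e`_m : A) * a) [RHS]eE; apply: eq_bigr => j _.
  by rewrite -[LHS]/((co j (e`_m * a))%:A * (e`_j : A)) -scalerAl mul1r.
exists (Linear_of rL) => p; rewrite /= /r -[RHS]sK fgliftE.
pose D j : {freeg P / k} :=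
  \sum_(x <- dom (s p)) << co j (coeff x (s p)) *g x >>.
have tD j : t j (i p) = \sum_(x <- dom (s p)) act (co j (coeff x (s p)))%:A x.
  have -> : t j (i p) = T (ev (D j)).
    congr (T _); apply/funext => x; rewrite /u psiE /ev coeff_sum_dom ?uniq_dom //.
    by move=> {}x /coeff_outdom ->; rewrite /co linear0.
  rewrite [T _]TE linear_sum; apply: eq_bigr => x _.
  by rewrite /= liftU.
under eq_bigr => j _ do rewrite tD /act scaler_sumr.
rewrite exchange_big; apply: eq_bigr => x _.
under eq_bigr => j _ do rewrite scalerA.
rewrite -scaler_suml; congr (_ *: _); rewrite [RHS]eE; apply: eq_bigr => j _.
by rewrite -[LHS]/((co j (coeff x (s p)))%:A * (e`_j : A)) -scalerAl mul1r.
Qed.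

Lemma fin_gen_regular (R : pzRingType) : fin_gen (R^o).
Proof.
exists 1%N, (fun=> 1) => x; exists (fun=> x).
by rewrite big_ord1 [RHS]mulr1.
Qed.

Lemma projdim_eq0 (M : rmodType A) n :
    (forall N : rmodType A,
       fin_gen N -> torsion_generated (@fin_gen_injective (A^c)%type) N) ->
  is_projdim M n -> n = 0%N.
Proof.
move=> gen [[P [d [e res]]] minM]; case: n => // n in res minM *.
have [pP eS d0e dd P0] := res.
have dI : injective (d n).
  move=> x y dxy; apply/eqP; rewrite -subr_eq0.
  have /dd[z <-] : d n (x - y) = 0 by rewrite linearB dxy subrr.
  by rewrite (P0 n.+2 _ z) ?linear0.
have [_ extA] := gen _ (fin_gen_regular _) _
  (extends_along_torsion (d n) (pP n.+1) (pP n)) (fun N '(conj fN iN) =>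
  conj fN (fun f => iN _ _ (d n) f dI)).
have [r rK] := split_mono (pP n.+1) extA.
by have := minM n (drop_last res rK); rewrite ltnn.
Qed.

End Algebra.

Theorem corollary5p5 (k : fieldType) (Lambda : falgType k)
  (Hgen : forall M : rmodType Lambda,
     fin_gen M -> torsion_generated (@fin_gen_injective (Lambda^c)%type) M) :
  Findim_finite Lambda.
Proof.
by exists 0%N; split=> // M n /(projdim_eq0 Hgen) ->.
Qed.
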